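(* Let $(p_n)$, $(q_n)$ be sequences with $0<q_n<p_n\le1$ such that $st\text{-}\lim_{n\to\infty}q_n=1$, $st\text{-}\lim_{n\to\infty}q_n^n=a$, $st\text{-}\lim_{n\to\infty}p_n=1$, $st\text{-}\lim_{n\to\infty}p_n^n=b$. Then for all $f\in C[0,1]$, $$st\text{-}\lim_{n\to\infty}\left\|\widetilde{M}_{n,k}^{(p_n,q_n)}(f;\cdot)-f\right\|_{C[0,1]}=0.$$
   Context: A real sequence $(x_n)$ is statistically convergent to $L$, written $st\text{-}\lim_n x_n=L$, if for every $\varepsilon>0$ the set $S=\{n\in\mathbb{N}:|x_n-L|\ge\varepsilon\}$ has natural density $0$, i.e. $\lim_{N\to\infty}\frac1N\#\{j\le N: j\in S\}=0$. $\|\cdot\|_{C[0,1]}$ is the supremum norm on $[0,1]$. For $0<q<p\le1$: $[n]_{p,q}=\frac{p^n-q^n}{p-q}$; $[n]_{p,q}!=[1]_{p,q}\cdots[n]_{p,q}$, $[0]_{p,q}!=1$; $\begin{bmatrix}n\\k\end{bmatrix}_{p,q}=\frac{[n]_{p,q}!}{[k]_{p,q}![n-k]_{p,q}!}$; $(x+y)_{p,q}^n=\prod_{j=0}^{n-1}(p^jx+q^jy)$. The $(p,q)$-integral is $\int_0^a f(t)\,d_{p,q}t=(p-q)a\sum_{j=0}^\infty \frac{q^j}{p^{j+1}}f\!\left(\frac{q^j}{p^{j+1}}a\right)$. Define $m_{n,k}^{(p,q)}(x)=\frac{1}{p^{kn+n(n+1)/2}}\begin{bmatrix}n+k\\k\end{bmatrix}_{p,q}x^k(1-x)^{n+1}_{p,q}$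 and $b_{n,k}^{(p,q)}(qt)=\frac{1}{p^{k(n-1)+n(n-1)/2}}\begin{bmatrix}n+k+1\\k\end{bmatrix}_{p,q}(qt)^k(1-qt)^n_{p,q}$. The operator is $$\widetilde{M}_{n,k}^{(p,q)}(f;x)=\frac{[n+1]_{p,q}}{p^n}\sum_{k=0}^\infty m_{n,k}^{(p,q)}(x)\,(pq)^{-k}\int_0^1 b_{n,k}^{(p,q)}(qt)f(t)\,d_{p,q}t,\quad 0\le x<1,$$ and $\widetilde{M}_{n,k}^{(p,q)}(f;1)=f(1)$.
   Formalization: The (p,q)-integral over [0,1] evaluates f at points such as 1/p > 1 when p < 1, so the operator is undefined for f given only on [0,1]; f is taken to be any continuous function on the whole real line (any continuous extension of f in C[0,1]). *)

(* Defs.v *)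
From HB Require Import structures.
From mathcomp Require Import all_boot all_order all_algebra.
From mathcomp Require Import all_classical all_reals all_analysis.
Set Implicit Arguments. Unset Strict Implicit. Unset Printing Implicit Defensive.
Import Order.TTheory GRing.Theory Num.Theory.
Import numFieldNormedType.Exports.
Local Open Scope classical_set_scope.
Local Open Scope ring_scope.

Section PQ.
Variable R : realType.

Definition density_zero (S : nat -> Prop) : Prop :=
  (fun N : nat => (N%:R)^-1 * (\sum_(1 <= j < N.+1) (if `[< S j >] then 1 else 0) : R))
    @ \oo --> (0 : R).

Definition st_lim (x : nat -> R) (L : R) : Prop :=
  forall eps : R, 0 < eps -> density_zero (fun n => eps <= `|x n - L|).

Definition pq_int (p q : R) (n : nat) : R := (p ^+ n - q ^+ n) / (p - q).
Definition pq_fact (p q : R) (n : nat) : R := \prod_(1 <= i < n.+1) pq_int p q i.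
Definition pq_binom (p q : R) (n k : nat) : R :=
  pq_fact p q n / (pq_fact p q k * pq_fact p q (n - k)).
Definition pq_pow (p q x y : R) (n : nat) : R :=
  \prod_(j < n) (p ^+ j * x + q ^+ j * y).

Definition rsum (u : nat -> R) : R := limn (series u).

Definition pq_integral (p q a : R) (f : R -> R) : R :=
  (p - q) * a * rsum (fun j => q ^+ j / p ^+ j.+1 * f (q ^+ j / p ^+ j.+1 * a)).

Definition m_nk (p q : R) (n k : nat) (x : R) : R :=
  (p ^+ (k * n + (n * n.+1)./2))^-1 * pq_binom p q (n + k) k * x ^+ k
  * pq_pow p q 1 (- x) n.+1.

(* b_{n,k}^{(p,q)}(q t); the exponent k(n-1)+n(n-1)/2 is an integer *)
Definition b_nk (p q : R) (n k : nat) (t : R) : R :=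
  (p ^ (k%:Z * (n%:Z - 1) + ((n * n.-1)./2)%:Z))^-1 * pq_binom p q (n + k.+1) k
  * (q * t) ^+ k * pq_pow p q 1 (- (q * t)) n.

Definition Mtilde (p q : R) (n : nat) (f : R -> R) (x : R) : R :=
  if x == 1 then f 1 else
  pq_int p q n.+1 / p ^+ n *
  rsum (fun k => m_nk p q n k x * (p * q) ^- k *
                pq_integral p q 1 (fun t => b_nk p q n k t * f t)).

Definition supnorm01 (g : R -> R) : R := sup [set `|g x| | x in `[0, 1]].

End PQ.

(* Main.v *)
(** With r = q / p all powers of p cancel: the operator at f is the average of
    f (r^j / p) against the r-Meyer-Koenig-Zeller weights m_{n,k}(x), followed
    by r-beta weights in j.  Both are nonnegative of total mass 1, by the
    q-binomial theorem and the q-beta integral.  With rho n k = [k] / [n + k],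
    the beta weights have moments rho (n+1) (k+1) and
    rho (n+1) (k+1) * rho (n+1) (k+2), while rho n k and rho n k * rho n (k-1)
    have m_{n,k}(x)-averages exactly x and x^2; since rho moves by at most
    1 / [n] when either index moves by one, the second moment of r^j about x is
    at most 6 / [n].  As |f y - f x| <= eps + K (y - x)^2 on a compact interval
    (Korovkin), the error is small uniformly in x as soon as n is large and q is
    close to 1, which holds off a set of density zero. *)
Require Import Defs.
From mathcomp Require Import all_boot all_order all_algebra.
From mathcomp Require Import all_classical all_reals all_analysis.
From mathcomp Require Import zify ring lra.
Set Implicit Arguments.
Unset Strict Implicit.
Unset Printing Implicit Defensive.
Import Order.TTheory GRing.Theory Num.Theory.
Import numFieldNormedType.Exports.
Local Open Scope classical_set_scope.
Local Open Scope ring_scope.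

Section Series.
Context {R : realType}.
Implicit Types (u v : nat -> R) (c l y z : R).

(* Convergence is required since [rsum] is a junk value on divergent series. *)
Definition has_sum u l := cvgn (series u) /\ rsum u = l.

Lemma has_sumP u l : has_sum u l <-> series u @ \oo --> l.
Proof. by split=> [[cu <-] //|hu]; split; [exact: cvgP hu|exact: cvg_lim]. Qed.

Lemma has_sum_rsum u l : has_sum u l -> rsum u = l.
Proof. by case. Qed.

Lemma eq_has_sum u v l : u =1 v -> has_sum u l -> has_sum v l.
Proof. by move=> /funext ->. Qed.

Lemma has_sumD u v l l' :
  has_sum u l -> has_sum v l' -> has_sum (fun k => u k + v k) (l + l').
Proof.
by move=> [cu <-] [cv <-]; split; [exact: is_cvg_seriesD|exact: lim_seriesD].
Qed.

Lemma has_sumZ c u l : has_sum u l -> has_sum (fun k => c * u k) (c * l).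
Proof.
by move=> [cu <-]; split; [exact: is_cvg_seriesZ|exact: lim_seriesZ].
Qed.

Lemma has_sum_shift u l :
  u 0%N = 0 -> has_sum (fun k => u k.+1) l -> has_sum u l.
Proof.
move=> u0 /has_sumP hu; apply/has_sumP; rewrite -cvg_shiftS.
suff -> : (fun n => series u n.+1) = series (fun k => u k.+1) by [].
by apply/funext => n; rewrite /series /= big_nat_recl //= u0 add0r.
Qed.

Lemma has_sum_ge0 u l : (forall k, 0 <= u k) -> has_sum u l -> 0 <= l.
Proof.
by move=> u0 [cu <-]; apply: limr_ge => //; apply: nearW => n; exact: sumr_ge0.
Qed.

Lemma has_sum_norm_le u v l : (forall k, `|u k| <= v k) -> has_sum v l ->
  exists2 l', has_sum u l' & `|l'| <= l.
Proof.
move=> uv [cv <-].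
have cu : cvgn [normed series u].
  apply: (@series_le_cvg _ _ v) => // n; first exact: normr_ge0.
  exact: le_trans (normr_ge0 _) (uv n).
exists (rsum u); first by split => //; exact: normed_cvg.
by apply: le_trans (lim_series_norm cu) _; exact: lim_series_le.
Qed.

Lemma ge0_has_sum u c :
  (forall k, 0 <= u k) -> (forall n, series u n <= c) -> has_sum u (rsum u).
Proof.
move=> u0 uc; split => //.
by apply: nondecreasing_is_cvgn; [exact: nondecreasing_series|
  exists c => _ [n _ <-]].
Qed.

Lemma series_le_has_sum u l n :
  (forall k, 0 <= u k) -> has_sum u l -> series u n <= l.
Proof.
move=> u0 [cu <-].
by apply: nondecreasing_cvgn_le; first exact: nondecreasing_series.
Qed.

Lemma has_sum_geometric z : 0 <= z < 1 -> has_sum (fun k => z ^+ k) (1 - z)^-1.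
Proof.
move=> /andP[z0 z1]; apply/has_sumP; rewrite -[(_)^-1]mul1r exprn_geometric.
by apply: cvg_geometric_series; rewrite ger0_norm.
Qed.

(* The recurrence says that the generating function of [v] is that of [u]
   multiplied by the geometric series of ratio [y]. *)
Lemma has_sum_geometric_conv u v l y : 0 <= y < 1 ->
  (forall k, 0 <= u k) -> has_sum u l ->
  v 0%N = u 0%N -> (forall k, v k.+1 = u k.+1 + y * v k) ->
  has_sum v (l / (1 - y)).
Proof.
move=> /andP[y0 y1] u0 hu v0 vS.
have v_ge0 k : 0 <= v k.
  by elim: k => [|k IH]; rewrite ?v0 ?vS // addr_ge0 // mulr_ge0.
have seriesE n : series u n.+1 = series v n.+1 - y * series v n.
  elim: n => [|n IH].
    by rewrite !seriesSr /series /= !big_geq // mulr0 subr0 v0.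
  by rewrite (seriesSr u n.+1) (seriesSr v n.+1) IH vS (seriesSr v n); ring.
have y1_gt0 : 0 < 1 - y by rewrite subr_gt0.
have series_v_le n : series v n <= l / (1 - y).
  have := series_le_has_sum n.+1 u0 hu; rewrite seriesE ler_pdivlMr // seriesSr.
  have := v_ge0 n; lra.
have hv := ge0_has_sum v_ge0 series_v_le; move/has_sumP: (hv) => hv'.
have hu' : series u n.+1 @[n --> \oo] --> rsum v - y * rsum v.
  under eq_fun do rewrite seriesE.
  by apply: cvgB; [rewrite cvg_shiftS|exact: cvgM (cvg_cst y) hv'].
have lE : l = rsum v - y * rsum v.
  apply: cvg_unique hu' => //=; rewrite (cvg_shiftS (series u)).
  exact/has_sumP.
suff -> : l / (1 - y) = rsum v by [].
by rewrite lE; field; rewrite gt_eqF.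
Qed.

End Series.

Section MixedSum.
Context {R : realType}.
Variables (m : nat -> R) (w : nat -> nat -> R).
Implicit Types (g h : nat -> R) (c l : R).

Definition has_mixed_sum g l := exists2 G : nat -> R,
  forall k, has_sum (fun j => w k j * g j) (G k) &
  has_sum (fun k => m k * G k) l.

Lemma has_mixed_sumD g h l l' : has_mixed_sum g l -> has_mixed_sum h l' ->
  has_mixed_sum (fun j => g j + h j) (l + l').
Proof.
move=> [G hG hl] [H hH hl']; exists (fun k => G k + H k) => [k|].
  by apply: eq_has_sum (has_sumD (hG k) (hH k)) => j; rewrite mulrDr.
by apply: eq_has_sum (has_sumD hl hl') => k; rewrite mulrDr.
Qed.

Lemma has_mixed_sumZ c g l :
  has_mixed_sum g l -> has_mixed_sum (fun j => c * g j) (c * l).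
Proof.
move=> [G hG hl]; exists (fun k => c * G k) => [k|].
  by apply: eq_has_sum (has_sumZ c (hG k)) => j; rewrite mulrCA.
by apply: eq_has_sum (has_sumZ c hl) => k; rewrite mulrCA.
Qed.

Lemma has_mixed_sum_cst c : has_sum m 1 -> (forall k, has_sum (w k) 1) ->
  has_mixed_sum (fun=> c) c.
Proof.
move=> m1 w1; exists (fun=> c) => [k|]; rewrite -[X in has_sum _ X]mulr1.
  by apply: eq_has_sum (has_sumZ c (w1 k)) => j; rewrite mulrC.
by apply: eq_has_sum (has_sumZ c m1) => k; rewrite mulrC.
Qed.

Hypotheses (m0 : forall k, 0 <= m k) (w0 : forall k j, 0 <= w k j).

Lemma has_mixed_sum_norm_le g h l :
  (forall j, `|g j| <= h j) -> has_mixed_sum h l ->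
  exists2 l', has_mixed_sum g l' & `|l'| <= l.
Proof.
move=> gh [H hH hl].
suff /choice[G hG] : forall k, exists d,
    has_sum (fun j => w k j * g j) d /\ `|d| <= H k.
  have [k|l' hl' l'l] := has_sum_norm_le (u := fun k => m k * G k) _ hl.
    by rewrite normrM ger0_norm // ler_wpM2l //; have [] := hG k.
  by exists l' => //; exists G => // k; have [] := hG k.
move=> k.
have [j|d hd d_le] := has_sum_norm_le (u := fun j => w k j * g j) _ (hH k).
  by rewrite normrM ger0_norm // ler_wpM2l.
by exists d.
Qed.

End MixedSum.

Section PQRecurrences.
Context {R : realType}.
Implicit Types (p q x y : R) (n : nat).

Lemma pq_fact0 p q : pq_fact p q 0 = 1.
Proof. by rewrite /pq_fact big_geq. Qed.

Lemma pq_factS p q n : pq_fact p q n.+1 = pq_fact p q n * pq_int p q n.+1.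
Proof. by rewrite /pq_fact big_nat_recr. Qed.

Lemma pq_pow0 p q x y : pq_pow p q x y 0 = 1.
Proof. by rewrite /pq_pow big_ord0. Qed.

Lemma pq_powS p q x y n :
  pq_pow p q x y n.+1 = pq_pow p q x y n * (p ^+ n * x + q ^+ n * y).
Proof. by rewrite /pq_pow big_ord_recr. Qed.

End PQRecurrences.

Section QCalculus.
Context {R : realType}.
Variable r : R.
Hypotheses (r0 : 0 < r) (r1 : r < 1).
Implicit Types (x y : R) (m n k j : nat).

Local Notation "`[ n ]" := (pq_int 1 r n).
Local Notation "`[ n ]!" := (pq_fact 1 r n).
Local Notation qbinom := (pq_binom 1 r).
Local Notation qpochhammer x := (pq_pow 1 r 1 (- x)).

Let subr_neq0 : 1 - r != 0. Proof. by rewrite subr_eq0 gt_eqF. Qed.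
Let r_ge0 : 0 <= r. Proof. exact: ltW. Qed.
Let r_le1 : r <= 1. Proof. exact: ltW. Qed.

Lemma qint_sum n : `[n] = \sum_(i < n) r ^+ i.
Proof.
apply: (canLR (mulfK subr_neq0)).
by rewrite expr1n -opprB subrX1 -mulNr opprB mulrC.
Qed.

Lemma qint0 : `[0] = 0.
Proof. by rewrite qint_sum big_ord0. Qed.

Lemma qintS n : `[n.+1] = `[n] + r ^+ n.
Proof. by rewrite !qint_sum big_ord_recr. Qed.

Lemma qintD m n : `[m + n] = `[m] + r ^+ m * `[n].
Proof. by rewrite /pq_int !expr1n exprD; field. Qed.

Lemma qint_ge0 n : 0 <= `[n].
Proof. by rewrite qint_sum sumr_ge0 // => i _; rewrite exprn_ge0. Qed.

Lemma qint_gt0 n : (0 < n)%N -> 0 < `[n].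
Proof. by case: n => // n _; rewrite qintS ltr_wpDl ?qint_ge0 ?exprn_gt0. Qed.

Lemma qint_neq0 n : `[n.+1] != 0.
Proof. by rewrite gt_eqF ?qint_gt0. Qed.

Lemma qint_le m n : (m <= n)%N -> `[m] <= `[n].
Proof.
by move=> /subnKC <-; rewrite qintD lerDl mulr_ge0 ?qint_ge0 ?exprn_ge0.
Qed.

Lemma qint_ge_mulrn n : n%:R * r ^+ n <= `[n].
Proof.
rewrite qint_sum mulr_natl -[X in _ *+ X]card_ord -sumr_const.
by apply: ler_sum => i _; rewrite ler_wiXn2l // ltnW.
Qed.

Lemma qfact_gt0 n : 0 < `[n]!.
Proof.
by elim: n => [|n IH]; rewrite ?pq_fact0 // pq_factS mulr_gt0 ?qint_gt0.
Qed.

Lemma qfact_neq0 n : `[n]! != 0.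
Proof. by rewrite gt_eqF ?qfact_gt0. Qed.

Lemma qbinomE n k : qbinom (n + k) k = `[n + k]! / (`[k]! * `[n]!).
Proof. by rewrite /pq_binom addnK. Qed.

Lemma qbinom0 n : qbinom n 0 = 1.
Proof. by rewrite /pq_binom subn0 pq_fact0 mul1r divff // qfact_neq0. Qed.

Lemma qbinomnn n : qbinom n n = 1.
Proof. by rewrite /pq_binom subnn pq_fact0 mulr1 divff // qfact_neq0. Qed.

Lemma qbinom_ge0 n k : 0 <= qbinom n k.
Proof. by rewrite divr_ge0 ?mulr_ge0 // ltW ?qfact_gt0. Qed.

Lemma qbinom_pascal n k : qbinom (n.+1 + k.+1) k.+1 =
  qbinom (n + k.+1) k.+1 + r ^+ n.+1 * qbinom (n.+1 + k) k.
Proof.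
rewrite !qbinomE [(n.+1 + k.+1)%N]addnS [(n + k.+1)%N]addnS -addSn.
rewrite [`[(n.+1 + k).+1]!]pq_factS -addnS qintD.
rewrite !(pq_factS 1 r n) !(pq_factS 1 r k).
by field; rewrite ?qint_neq0 ?qfact_neq0.
Qed.

Lemma qpochhammerS x n :
  qpochhammer x n.+1 = qpochhammer x n * (1 - r ^+ n * x).
Proof. by rewrite pq_powS expr1n mulr1 mulrN. Qed.

Lemma qpochhammer_gt0 x n : 0 <= x < 1 -> 0 < qpochhammer x n.
Proof.
move=> /andP[x0 x1]; elim: n => [|n IH]; first by rewrite pq_pow0.
rewrite qpochhammerS mulr_gt0 // subr_gt0.
by apply: le_lt_trans x1; rewrite ler_piMl // exprn_ile1.
Qed.

Lemma has_sum_qbinom n x : 0 <= x < 1 ->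
  has_sum (fun k => qbinom (n + k) k * x ^+ k) (qpochhammer x n.+1)^-1.
Proof.
move=> x01; have /andP[x0 x1] := x01; elim: n => [|n IH].
  rewrite qpochhammerS pq_pow0 expr0 !mul1r.
  by apply: eq_has_sum (has_sum_geometric x01) => k; rewrite qbinomnn mul1r.
rewrite qpochhammerS invfM.
apply: (has_sum_geometric_conv _ _ IH) => [|k||k].
- rewrite mulr_ge0 ?exprn_ge0 //=.
  by apply: le_lt_trans x1; rewrite ler_piMl // exprn_ile1.
- by rewrite mulr_ge0 ?qbinom_ge0 ?exprn_ge0.
- by rewrite !qbinom0.
- by rewrite qbinom_pascal [x ^+ _]exprS; ring.
Qed.

Lemma has_sum_qbeta n k :
  has_sum (fun j =>
      (1 - r) * r ^+ j * (r ^+ j) ^+ k * qpochhammer (r ^+ j.+1) n)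
    (`[k]! * `[n]! / `[(n + k).+1]!).
Proof.
elim: n k => [|n IH] k.
  have rk : 0 <= r ^+ k.+1 < 1 by rewrite exprn_ge0 // exprn_ilt1.
  rewrite (_ : _ / _ = (1 - r) * (1 - r ^+ k.+1)^-1); last first.
    rewrite add0n pq_fact0 pq_factS /pq_int expr1n; field.
    by rewrite qfact_neq0 subr_neq0 subr_eq0 gt_eqF //; case/andP: rk.
  apply: eq_has_sum (has_sumZ (1 - r) (has_sum_geometric rk)) => j.
  by rewrite pq_pow0 mulr1 -mulrA -exprS -!exprM mulnC.
rewrite (_ : _ / _ = `[k]! * `[n]! / `[(n + k).+1]! +
    - r ^+ n.+1 * (`[k.+1]! * `[n]! / `[(n + k.+1).+1]!)); last first.
  have qintnE : `[n.+1] = `[(n + k).+2] - r ^+ n.+1 * `[k.+1].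
    by rewrite -addnS -addSn qintD addrK.
  rewrite addnS addSn (pq_factS 1 r (n + k).+1) (pq_factS 1 r n).
  by rewrite (pq_factS 1 r k) qintnE; field; rewrite qint_neq0 qfact_neq0.
apply: eq_has_sum (has_sumD (IH k) (has_sumZ (- r ^+ n.+1) (IH k.+1))) => j.
by rewrite qpochhammerS !exprS; ring.
Qed.

(* The node of the [q]-Meyer-Koenig-Zeller operator that carries the weight
   [m_nk 1 r n k]; it has the junk value [0] at [n = k = 0]. *)
Definition qratio n k := `[k] / `[n + k].

Lemma qratio0 n : qratio n 0 = 0.
Proof. by rewrite /qratio qint0 mul0r. Qed.

Lemma qratio_ge0 n k : 0 <= qratio n k.
Proof. by rewrite divr_ge0 // qint_ge0. Qed.

Lemma qratio_le1 n k : (0 < n)%N -> qratio n k <= 1.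
Proof.
move=> n0; rewrite ler_pdivrMr ?qint_gt0 ?addn_gt0 ?n0 // mul1r.
by rewrite qint_le // leq_addl.
Qed.

Lemma div_qint_itv m n x : (0 < m <= n)%N -> 0 <= x <= 1 ->
  0 <= x / `[n] <= `[m]^-1.
Proof.
move=> /andP[m0 mn] /andP[x0 x1]; have n0 := leq_trans m0 mn.
rewrite divr_ge0 ?qint_ge0 //=; apply: le_trans (_ : `[n]^-1 <= _).
  by rewrite ler_piMl // invr_ge0 qint_ge0.
by rewrite lef_pV2 ?posrE ?qint_gt0 // qint_le.
Qed.

Lemma qratioSr_itv n k : (0 < n)%N ->
  qratio n k <= qratio n k.+1 <= qratio n k + `[n]^-1.
Proof.
move=> n0; have nk : (0 < n + k)%N by rewrite addn_gt0 n0.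
have -> : qratio n k.+1 =
    qratio n k + r ^+ k * (`[n] / `[n + k]) / `[(n + k).+1].
  have := qint_gt0 nk; have := qint_neq0 (n + k).
  rewrite /qratio addnS !qintS qintD exprD => nkS_neq0 /gt_eqF nk_neq0.
  by field; rewrite nk_neq0; apply/andP.
rewrite lerDl lerD2l; apply: div_qint_itv; first by rewrite n0 -addnS leq_addr.
have /andP[ratio0 ratio1] : 0 <= `[n] / `[n + k] <= 1.
  rewrite divr_ge0 ?qint_ge0 //= ler_pdivrMr ?qint_gt0 // mul1r.
  by rewrite qint_le // leq_addr.
by apply/andP; split; [apply: mulr_ge0|apply: mulr_ile1];
  rewrite ?exprn_ge0 ?exprn_ile1.
Qed.

Lemma qratioSl_itv n k : (0 < n)%N ->
  qratio n.+1 k <= qratio n k <= qratio n.+1 k + `[n]^-1.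
Proof.
move=> n0; have nk : (0 < n + k)%N by rewrite addn_gt0 n0.
have -> : qratio n k =
    qratio n.+1 k + r ^+ (n + k) * qratio n k / `[(n + k).+1].
  have := qint_gt0 nk; have := qint_neq0 (n + k).
  rewrite /qratio addSn !qintS => nkS_neq0 /gt_eqF nk_neq0.
  by field; rewrite nk_neq0; apply/andP.
rewrite lerDl lerD2l; apply: div_qint_itv; first by rewrite n0 -addnS leq_addr.
by apply/andP; split; [apply: mulr_ge0|apply: mulr_ile1];
  rewrite ?qratio_ge0 ?qratio_le1 ?exprn_ge0 ?exprn_ile1.
Qed.

Lemma qratio_second_moment_le n k x : (0 < n)%N -> 0 <= x <= 1 ->
  qratio n.+1 k.+1 * qratio n.+1 k.+2 - 2 * x * qratio n.+1 k.+1 + x ^+ 2 <=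
  qratio n k * qratio n k.-1 - 2 * x * qratio n k + x ^+ 2 + 6 / `[n].
Proof.
move=> n0 /andP[x0 x1].
have e0 : 0 < `[n]^-1 by rewrite invr_gt0 qint_gt0.
have mean_le : qratio n.+1 k.+1 <= qratio n k + `[n]^-1.
  have /andP[] := qratioSl_itv k.+1 n0; have /andP[] := qratioSr_itv k n0; lra.
have mean_ge : qratio n k - `[n]^-1 <= qratio n.+1 k.+1.
  have /andP[] := qratioSl_itv k.+1 n0; have /andP[] := qratioSr_itv k n0; lra.
have next_le : qratio n.+1 k.+2 <= qratio n k.-1 + 3 / `[n].
  have /andP[+ _] := qratioSl_itv k.+2 n0.
  have /andP[_ +] := qratioSr_itv k.+1 n0; have /andP[_ +] := qratioSr_itv k n0.
  have : qratio n k <= qratio n k.-1 + `[n]^-1.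
    by case: (k) => [|i]; [rewrite lerDl ltW|have /andP[] := qratioSr_itv i n0].
  lra.
have prod_le : qratio n.+1 k.+1 * qratio n.+1 k.+2 <=
    qratio n k * qratio n k.-1 + 4 / `[n].
  have := ler_wpM2r (qratio_ge0 n.+1 k.+2) mean_le.
  have := ler_wpM2l (qratio_ge0 n k) next_le.
  have := ler_wpM2l (ltW e0) (qratio_le1 k.+2 (ltn0Sn n)).
  have := ler_wpM2l (ltW e0) (qratio_le1 k n0).
  lra.
have := ler_wpM2l x0 mean_ge; have := ler_wpM2l (ltW e0) x1; lra.
Qed.

Lemma m_nkE n k x :
  m_nk 1 r n k x = qbinom (n + k) k * x ^+ k * qpochhammer x n.+1.
Proof. by rewrite /m_nk expr1n invr1 mul1r. Qed.

Lemma m_nk_ge0 n k x : 0 <= x < 1 -> 0 <= m_nk 1 r n k x.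
Proof.
move=> x01; have /andP[x0 _] := x01.
rewrite m_nkE mulr_ge0 //; last exact/ltW/qpochhammer_gt0.
by rewrite mulr_ge0 ?qbinom_ge0 ?exprn_ge0.
Qed.

Lemma has_sum_m_nk n x : 0 <= x < 1 -> has_sum (fun k => m_nk 1 r n k x) 1.
Proof.
move=> x01.
rewrite -[X in has_sum _ X](divff (lt0r_neq0 (qpochhammer_gt0 n.+1 x01))).
apply: eq_has_sum (has_sumZ _ (has_sum_qbinom n x01)) => k.
by rewrite m_nkE mulrC.
Qed.

Lemma m_nkS n k x : m_nk 1 r n k.+1 x * qratio n k.+1 = x * m_nk 1 r n k x.
Proof.
rewrite !m_nkE !qbinomE /qratio addnS !pq_factS exprS; field.
by rewrite !qint_neq0 !qfact_neq0.
Qed.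

Lemma has_sum_m_nk_qratio n x (g : nat -> R) l :
  has_sum (fun k => m_nk 1 r n k x * g k) l ->
  has_sum (fun k => m_nk 1 r n k x * (qratio n k * g k.-1)) (x * l).
Proof.
move=> hg; apply: has_sum_shift; first by rewrite qratio0 mul0r mulr0.
by apply: eq_has_sum (has_sumZ x hg) => k; rewrite [RHS]mulrA m_nkS mulrA.
Qed.

Lemma has_sum_m_nk_second_moment n x : 0 <= x < 1 ->
  has_sum (fun k => m_nk 1 r n k x *
    (qratio n k * qratio n k.-1 - 2 * x * qratio n k + x ^+ 2)) 0.
Proof.
move=> x01; have mass := has_sum_m_nk n x01.
have mean : has_sum (fun k => m_nk 1 r n k x * qratio n k) x.
  rewrite -[X in has_sum _ X]mulr1.
  apply: eq_has_sum (has_sum_m_nk_qratio (g := fun=> 1) _) => [k|].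
    by rewrite mulr1.
  by apply: eq_has_sum mass => k; rewrite mulr1.
have := has_sumD (has_sumD (has_sum_m_nk_qratio mean)
  (has_sumZ (- (2 * x)) mean)) (has_sumZ (x ^+ 2) mass).
rewrite (_ : _ + _ = 0); last by ring.
by apply: eq_has_sum => k; ring.
Qed.

(* [b_nk] times the weights of the [q]-integral, normalised: the [q]-beta
   distribution on the nodes [r ^+ j]. *)
Definition qbeta_weight n k j : R :=
  `[(n + k).+1]! / (`[k]! * `[n]!) *
  ((1 - r) * r ^+ j * (r ^+ j) ^+ k * qpochhammer (r ^+ j.+1) n).

Lemma qbeta_weight_ge0 n k j : 0 <= qbeta_weight n k j.
Proof.
have rj : 0 <= r ^+ j.+1 < 1 by rewrite exprn_ge0 // exprn_ilt1.
rewrite mulr_ge0 ?divr_ge0 ?mulr_ge0 ?(ltW (qfact_gt0 _)) //.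
- by rewrite subr_ge0.
- by rewrite exprn_ge0.
- by rewrite !exprn_ge0.
- exact/ltW/qpochhammer_gt0.
Qed.

Lemma has_sum_qbeta_weight n k : has_sum (qbeta_weight n k) 1.
Proof.
rewrite [X in has_sum _ X](_ : 1 = `[(n + k).+1]! / (`[k]! * `[n]!) *
    (`[k]! * `[n]! / `[(n + k).+1]!)); last by field; rewrite !qfact_neq0.
exact: has_sumZ (has_sum_qbeta n k).
Qed.

Lemma qbeta_weightS n k j :
  qbeta_weight n k j * r ^+ j = qratio n.+1 k.+1 * qbeta_weight n k.+1 j.
Proof.
rewrite /qbeta_weight /qratio addSn addnS !pq_factS [_ ^+ k.+1]exprS; field.
by rewrite !qint_neq0 !qfact_neq0.
Qed.

Lemma has_sum_qbeta_weight_second_moment n k x :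
  has_sum (fun j => qbeta_weight n k j * (r ^+ j - x) ^+ 2)
    (qratio n.+1 k.+1 * qratio n.+1 k.+2 - 2 * x * qratio n.+1 k.+1 + x ^+ 2).
Proof.
have mass := has_sum_qbeta_weight n.
have := has_sumD (has_sumD
  (has_sumZ (qratio n.+1 k.+1 * qratio n.+1 k.+2) (mass k.+2))
  (has_sumZ (- (2 * x) * qratio n.+1 k.+1) (mass k.+1)))
  (has_sumZ (x ^+ 2) (mass k)).
rewrite !mulr1 mulNr; apply: eq_has_sum => j.
move: (qbeta_weightS n k j) (qbeta_weightS n k.+1 j).
move: (r ^+ j) (qbeta_weight n k j) (qbeta_weight n k.+1 j)
  (qbeta_weight n k.+2 j) => y w0 w1 w2 w0y w1y.
have -> : w0 * (y - x) ^+ 2 = w0 * y * y - 2 * x * (w0 * y) + x ^+ 2 * w0.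
  by ring.
by rewrite w0y -[_ * w1 * y]mulrA w1y; ring.
Qed.

Lemma has_mixed_sum_second_moment n x : (0 < n)%N -> 0 <= x < 1 ->
  exists2 v, has_mixed_sum (fun k => m_nk 1 r n k x) (qbeta_weight n)
      (fun j => (r ^+ j - x) ^+ 2) v &
    v <= 6 / `[n].
Proof.
move=> n0 x01; have m0 k := m_nk_ge0 n k x01.
have x01' : 0 <= x <= 1 by case/andP: x01 => -> /ltW.
pose inner k :=
  qratio n.+1 k.+1 * qratio n.+1 k.+2 - 2 * x * qratio n.+1 k.+1 + x ^+ 2.
have inner_sum k := has_sum_qbeta_weight_second_moment n k x.
have inner_ge0 k : 0 <= inner k.
  apply: has_sum_ge0 (inner_sum k) => j.
  by rewrite mulr_ge0 ?qbeta_weight_ge0 ?sqr_ge0.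
have := has_sumD (has_sum_m_nk_second_moment n x01)
  (has_sumZ (6 / `[n]) (has_sum_m_nk n x01)); rewrite add0r mulr1 => outer_sum.
have [k|v hv v_le] :=
    has_sum_norm_le (u := fun k => m_nk 1 r n k x * inner k) _ outer_sum.
  rewrite normrM !ger0_norm //.
  have := ler_wpM2l (m0 k) (qratio_second_moment_le k n0 x01').
  by move: (m_nk 1 r n k x) => mk; rewrite /inner; lra.
by exists v; [exists inner|exact: le_trans (ler_norm v) v_le].
Qed.

End QCalculus.

Section Scaling.
Context {R : realType}.
Variables p q : R.
Hypotheses (q0 : 0 < q) (qp : q < p).
Implicit Types (f : R -> R) (x y : R) (n k j : nat).

Local Notation r := (q / p).
Local Notation qbinom := (pq_binom 1 r).
Local Notation qpochhammer x := (pq_pow 1 r 1 (- x)).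

Let p0 : 0 < p. Proof. exact: lt_trans q0 qp. Qed.
Let p_neq0 : p != 0. Proof. by rewrite gt_eqF. Qed.
Let pq_neq0 : p - q != 0. Proof. by rewrite subr_eq0 gt_eqF. Qed.
Let r0 : 0 < r. Proof. by rewrite divr_gt0. Qed.
Let r1 : r < 1. Proof. by rewrite ltr_pdivrMr ?mul1r. Qed.

Lemma pq_int_scale n : pq_int p q n.+1 = p ^+ n * pq_int 1 r n.+1.
Proof.
rewrite /pq_int expr1n expr_div_n [p ^+ n.+1]exprS; field.
by rewrite p_neq0 pq_neq0 expf_neq0.
Qed.

Lemma pq_fact_scale n : pq_fact p q n = p ^+ 'C(n, 2) * pq_fact 1 r n.
Proof.
elim: n => [|n IH]; first by rewrite !pq_fact0 bin0n mulr1.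
by rewrite !pq_factS IH pq_int_scale binS bin1 exprD; ring.
Qed.

Lemma pq_binom_scale n k :
  pq_binom p q (n + k) k = p ^+ (k * n) * qbinom (n + k) k.
Proof.
have bin2D : 'C(n + k, 2) = (k * n + 'C(k, 2) + 'C(n, 2))%N.
  elim: n => [|n IH]; first by rewrite muln0 bin0n addn0.
  by rewrite addSn !binS !bin1 IH mulnS; lia.
rewrite /pq_binom addnK !pq_fact_scale bin2D !exprD; field.
by rewrite !qfact_neq0 // !expf_neq0.
Qed.

Lemma pq_pow_scale y n :
  pq_pow p q 1 y n = p ^+ 'C(n, 2) * pq_pow 1 r 1 y n.
Proof.
elim: n => [|n IH]; first by rewrite !pq_pow0 mulr1.
rewrite !pq_powS IH binS bin1 exprD expr_div_n expr1n; field.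
by rewrite expf_neq0.
Qed.

Lemma m_nk_scale n k x : m_nk p q n k x = m_nk 1 r n k x.
Proof.
rewrite m_nkE /m_nk pq_binom_scale pq_pow_scale.
rewrite bin2 /= mulnC [(n.+1 * n)%N]mulnC exprD; field.
by rewrite !expf_neq0.
Qed.

Lemma b_nk_scale n k t : b_nk p q n k t =
  p ^+ k * p ^+ k * qbinom (n.+1 + k) k * (q * t) ^+ k * qpochhammer (q * t) n.
Proof.
have exponentE : p ^ (k%:Z * (n%:Z - 1) + 'C(n, 2)%:Z) =
    p ^+ (k * n.+1) * p ^+ 'C(n, 2) / (p ^+ k * p ^+ k).
  rewrite -!exprD; apply: (canRL (mulfK _)); first by rewrite expf_neq0.
  rewrite [p ^+ (k + k)]exprnP [RHS]exprnP -expfzDr //; congr (_ ^ _).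
  by lia.
rewrite /b_nk addnS -addSn pq_binom_scale pq_pow_scale -bin2 exponentE.
by field; rewrite !expf_neq0.
Qed.

Lemma pq_integral_b_nk n k f l :
  has_sum (fun j => qbeta_weight r n k j * f (r ^+ j / p)) l ->
  pq_integral p q 1 (fun t => b_nk p q n k t * f t) =
  (p * q) ^+ k / pq_int 1 r n.+1 * l.
Proof.
move=> hl; have N0 : pq_int 1 r n.+1 != 0 by exact: qint_neq0.
have nodeE j : q ^+ j / p ^+ j.+1 = r ^+ j / p.
  by rewrite expr_div_n exprSr invfM mulrA.
rewrite /pq_integral
  (_ : rsum _ = (p * q) ^+ k / pq_int 1 r n.+1 / (p - q) * l).
  by field; rewrite N0 pq_neq0.
rewrite -(has_sum_rsum (has_sumZ _ hl)); congr rsum; apply/funext => j.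
have qnodeE : q * (r ^+ j / p) = r ^+ j.+1 by rewrite exprS; ring.
rewrite !mulr1 !nodeE b_nk_scale qnodeE /qbeta_weight qbinomE addSn !pq_factS.
rewrite [r ^+ j.+1 ^+ k](_ : _ = q ^+ k / p ^+ k * r ^+ j ^+ k); last first.
  by rewrite exprS exprMn expr_div_n.
rewrite [(p * q) ^+ k]exprMn; move: (r ^+ j) => s; field.
by rewrite !qfact_neq0 // N0 p_neq0 pq_neq0 expf_neq0.
Qed.

Lemma Mtilde_has_mixed_sum n f x l : x != 1 ->
  has_mixed_sum (fun k => m_nk 1 r n k x) (qbeta_weight r n)
    (fun j => f (r ^+ j / p)) l ->
  Mtilde p q n f x = l.
Proof.
move=> x1 [G hG hl]; rewrite /Mtilde (negbTE x1) pq_int_scale.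
have N0 : pq_int 1 r n.+1 != 0 by exact: qint_neq0.
rewrite (_ : rsum _ = (pq_int 1 r n.+1)^-1 * l).
  by field; rewrite N0 expf_neq0.
rewrite -(has_sum_rsum (has_sumZ _ hl)); congr rsum; apply/funext => k.
rewrite m_nk_scale (pq_integral_b_nk (hG k)); field.
by rewrite N0 expf_neq0 ?mulf_neq0 ?(gt_eqF q0).
Qed.

End Scaling.

Lemma sqr_dilation_sub_le (R : realDomainType) (s x c : R) : 0 <= s -> s <= 1 ->
  (s * c - x) ^+ 2 <= 2 * (c - 1) ^+ 2 + 2 * (s - x) ^+ 2.
Proof.
move=> s0 s1; have : (s * (c - 1)) ^+ 2 <= (c - 1) ^+ 2.
  by rewrite exprMn ler_piMl ?sqr_ge0 // exprn_ile1.
have := sqr_ge0 (s * (c - 1) - (s - x)); nra.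
Qed.

(* With [r = q / p], bounds the second moment about [x] of the nodes
   [r ^+ j / p]. *)
Definition moment_bound (R : realType) (p r : R) n : R :=
  12 / pq_int 1 r n + 2 * (p^-1 - 1) ^+ 2.

Lemma Mtilde_dist_le (R : realType) (p q : R) n (f : R -> R) x eps K :
  0 < q -> q < p -> (0 < n)%N -> 0 <= x < 1 -> 0 <= K ->
  (forall y, 0 <= y <= p^-1 -> `|f y - f x| <= eps + K * (y - x) ^+ 2) ->
  `|Mtilde p q n f x - f x| <= eps + K * moment_bound p (q / p) n.
Proof.
move=> q0 qp n0 x01 K0 f_le; have p0 := lt_trans q0 qp.
set r := q / p; have r0 : 0 < r by rewrite divr_gt0.
have r1 : r < 1 by rewrite ltr_pdivrMr ?mul1r.
have m0 k := m_nk_ge0 r0 r1 n k x01.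
have w0 := qbeta_weight_ge0 r0 r1 n.
have mean_cst c := has_mixed_sum_cst c (has_sum_m_nk r0 r1 n x01)
  (has_sum_qbeta_weight r0 r1 n).
have [V hV V_le] := has_mixed_sum_second_moment r0 r1 n0 x01.
have node_le j : `|f (r ^+ j / p) - f x| <=
    eps + 2 * K * (p^-1 - 1) ^+ 2 + 2 * K * (r ^+ j - x) ^+ 2.
  have s0 : 0 <= r ^+ j by rewrite exprn_ge0 // ltW.
  have s1 : r ^+ j <= 1 by rewrite exprn_ile1 ?ltW.
  apply: le_trans (f_le _ _) _.
    rewrite divr_ge0 ?(ltW p0) //=.
    by rewrite ler_piMl // invr_ge0 ltW.
  have := ler_wpM2l K0 (sqr_dilation_sub_le x p^-1 s0 s1); lra.
have [d hd d_le] := has_mixed_sum_norm_le m0 w0 node_le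
  (has_mixed_sumD (mean_cst _) (has_mixed_sumZ (2 * K) hV)).
have -> : Mtilde p q n f x = d + f x.
  apply: (Mtilde_has_mixed_sum q0 qp); first by case/andP: x01 => _ /lt_eqF ->.
  have [G hG hl] := has_mixed_sumD hd (mean_cst (f x)).
  exists G => // k; apply: eq_has_sum (hG k) => j.
  by rewrite subrK.
rewrite addrK; apply: le_trans d_le _.
have := ler_wpM2l K0 V_le; rewrite /moment_bound; lra.
Qed.

(* Near the diagonal the oscillation of [f] is at most [eps]; off the diagonal
   [`|x - y|] is locally bounded below; compactness of [A `*` A] makes [K]
   uniform. *)
Lemma continuous_quadratic_modulus (R : realType) (V W : normedModType R)
    (A : set V) (f : V -> W) (eps : R) :
  compact A -> continuous f -> 0 < eps -> \forall K \near +oo,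
    forall x y, A x -> A y -> `|f x - f y| <= eps + K * `|x - y| ^+ 2.
Proof.
move=> cA cf eps0.
have /compact_near_coveringP/(_ R +oo (fun K z =>
    `|f z.1 - f z.2| <= eps + K * `|z.1 - z.2| ^+ 2)) := compact_setX cA cA.
move=> near_cover; suff /near_cover : forall z, (A `*` A) z ->
    \forall z' \near z & K \near +oo,
      `|f z'.1 - f z'.2| <= eps + K * `|z'.1 - z'.2| ^+ 2.
  by apply: filterS => K AK x y Ax Ay; exact: (AK (x, y)).
move=> z _.
have cfst : z'.1 @[z' --> z] --> z.1 by exact: cvg_fst.
have csnd : z'.2 @[z' --> z] --> z.2 by exact: cvg_snd.
have cvg_dist : `|z'.1 - z'.2| @[z' --> z] --> `|z.1 - z.2|.
  exact: cvg_norm (cvgB cfst csnd).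
have cvg_osc : `|f z'.1 - f z'.2| @[z' --> z] --> `|f z.1 - f z.2|.
  apply: cvg_norm; apply: cvgB.
    exact: cvg_comp cfst (cf z.1).
  exact: cvg_comp csnd (cf z.2).
have [zE|/eqP z_neq] := eqVneq z.1 z.2.
  near=> z' K.
  have osc_le : `|f z'.1 - f z'.2| <= eps.
    by near: z'; apply: (cvgr_le _ cvg_osc); rewrite zE subrr normr0.
  have K0 : 0 <= K by near: K; exact: nbhs_pinfty_ge.
  by rewrite (le_trans osc_le) // lerDl mulr_ge0 ?exprn_ge0.
pose D := `|z.1 - z.2|; pose M := `|f z.1 - f z.2| + 1.
have D0 : 0 < D / 2 by rewrite divr_gt0 // normr_gt0 subr_eq0; apply/eqP.
near=> z' K.
have osc_le : `|f z'.1 - f z'.2| <= M.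
  by near: z'; apply: (cvgr_le _ cvg_osc); rewrite ltrDl.
have dist_ge : D / 2 <= `|z'.1 - z'.2|.
  near: z'; apply: (cvgr_ge _ cvg_dist); rewrite -/D; lra.
have K_ge : M / (D / 2) ^+ 2 <= K.
  by near: K; apply: nbhs_pinfty_ge; exact: num_real.
apply: le_trans osc_le _; rewrite ler_wpDl ?(ltW eps0) //.
move: K_ge; rewrite ler_pdivrMr ?exprn_gt0 // => /le_trans; apply.
by rewrite ler_wpM2l ?ler_pXn2r ?nnegrE ?(ltW D0).
Unshelve. all: by end_near. Qed.

Lemma continuous_quadratic_modulus_segment (R : realType) (f : R -> R)
    (a b eps : R) :
  continuous f -> 0 < eps -> exists2 K, 0 <= K &
    forall y x, a <= y <= b -> a <= x <= b ->
      `|f y - f x| <= eps + K * (y - x) ^+ 2.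
Proof.
move=> cf eps0.
have [K [K0 f_le]] := filter_ex (filterI (nbhs_pinfty_ge (num_real 0))
  (continuous_quadratic_modulus (@segment_compact _ a b) cf eps0)).
exists K => // y x y_ab x_ab; rewrite -[(y - x) ^+ 2]real_normK ?num_real //.
by apply: f_le; rewrite /= in_itv.
Qed.

Section UniformLimits.
Context {R : realType}.
Implicit Types (p q : R) (n : nat).

Local Notation oo_left1 := (filter_prod \oo (1 : R)^'-).

Lemma ler_qint n (r s : R) : 0 < r -> r <= s -> s < 1 ->
  pq_int 1 r n <= pq_int 1 s n.
Proof.
move=> r0 rs s1; rewrite !qint_sum //; last exact: le_lt_trans s1.
apply: ler_sum => i _.
by rewrite lerXn2r ?nnegrE ?(ltW r0) // (le_trans (ltW r0)).
Qed.

Lemma cvg_qint_pinfty :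
  pq_int 1 z.2 z.1 @[z --> oo_left1] --> +oo.
Proof.
apply/cvgryPge => M; pose m := Num.bound (2 * `|M|).
near=> n q => /=.
have q0 : 0 < q by near: q; exact: nbhs_left_gt.
have q1 : q < 1 by near: q; exact: nbhs_left_lt.
have half_le : 2^-1 <= q ^+ m.
  near: q; apply: (cvgr_ge (1 ^+ m)); last by rewrite expr1n invf_lt1 ?ltr1n.
  exact/cvg_at_left_filter/exprn_continuous.
have m_le_n : (m <= n)%N by near: n; exact: nbhs_infty_ge.
have M_le_m : 2 * `|M| < m%:R by rewrite archi_boundP // mulr_ge0.
apply: le_trans (qint_le q0 q1 m_le_n); apply: le_trans (qint_ge_mulrn q0 q1 m).
have := ler_wpM2l (ler0n R m) half_le; have := ler_norm M; lra.
Unshelve. all: by end_near. Qed.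

Lemma moment_bound_le n p q : (0 < n)%N -> 0 < q -> q < p <= 1 ->
  moment_bound p (q / p) n <= moment_bound q q n.
Proof.
move=> n0 q0 /andP[qp p1]; have p0 := lt_trans q0 qp.
have q1 : q < 1 := lt_le_trans qp p1.
apply: lerD; last first.
  have invp_ge1 : 1 <= p^-1 by rewrite invf_ge1.
  have invp_le : p^-1 <= q^-1 by rewrite lef_pV2 ?posrE // ltW.
  by rewrite ler_pM2l // lerXn2r ?nnegrE; lra.
have le_ratio : pq_int 1 q n <= pq_int 1 (q / p) n.
  by apply: ler_qint => //; [rewrite ler_peMr ?invf_ge1 // ltW|
    rewrite ltr_pdivrMr ?mul1r].
have qint_q_gt0 := qint_gt0 q0 q1 n0.
by rewrite ler_pM2l // lef_pV2 ?posrE // (lt_le_trans qint_q_gt0).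
Qed.

Lemma cvg_moment_bound :
  moment_bound z.2 z.2 z.1 @[z --> oo_left1] --> (0 : R).
Proof.
have inv_left : q^-1 @[q --> (1 : R)^'-] --> (1 : R).
  rewrite -[X in _ --> X]invr1.
  exact/cvg_at_left_filter/inv_continuous/oner_neq0.
have invq : z.2^-1 @[z --> oo_left1] --> (1 : R).
  exact: cvg_comp cvg_snd inv_left.
have inv_qint : (pq_int 1 z.2 z.1)^-1 @[z --> oo_left1] --> (0 : R).
  apply/gtr0_cvgV0; last exact: cvg_qint_pinfty.
  by move/cvgryPgt: cvg_qint_pinfty; exact.
have sub0 : z.2^-1 - 1 @[z --> oo_left1] --> (0 : R).
  by rewrite -[X in _ --> X](subrr 1); exact: cvgB invq (cvg_cst _).
have sqr0 : (z.2^-1 - 1) ^+ 2 @[z --> oo_left1] --> (0 : R).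
  by rewrite -[X in _ --> X](mulr0 0); apply: cvgM; exact: sub0.
rewrite -[X in _ --> X](_ : 12 * 0 + 2 * 0 = 0); last by rewrite !mulr0 addr0.
exact: cvgD (cvgM (cvg_cst _) inv_qint) (cvgM (cvg_cst _) sqr0).
Qed.

Lemma Mtilde_near_uniform (f : R -> R) (eps : R) : continuous f -> 0 < eps ->
  \forall n \near \oo & q \near (1 : R)^'-,
    forall p x, q < p <= 1 -> 0 <= x <= 1 -> `|Mtilde p q n f x - f x| <= eps.
Proof.
move=> cf eps0; have eps2 : 0 < eps / 2 by rewrite divr_gt0.
have [K K0 f_le] := continuous_quadratic_modulus_segment 0 2 cf eps2.
have : K * moment_bound z.2 z.2 z.1 @[z --> oo_left1] --> (0 : R).
  by rewrite -[X in _ --> X](mulr0 K); exact: cvgM (cvg_cst K) cvg_moment_bound.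
move/cvgr_le => /(_ _ eps2); apply: filter_app.
near=> n q => /= bound_le p x qp1 /andP[x0 x1]; have /andP[qp p1] := qp1.
have [->|x_neq1] := eqVneq x 1.
  by rewrite /Mtilde eqxx subrr normr0 ltW.
have q_ge : 2^-1 <= q by near: q; apply: nbhs_left_ge; rewrite invf_lt1 ?ltr1n.
have n0 : (0 < n)%N by near: n; exact: nbhs_infty_gt.
have q0 : 0 < q by lra.
have invp_le2 : p^-1 <= 2 by rewrite -[2]invrK lef_pV2 ?posrE ?invr_gt0 //; lra.
apply: le_trans (Mtilde_dist_le q0 qp n0 _ K0 (eps := eps / 2) _) _.
- by rewrite x0 lt_neqAle x_neq1.
- by move=> y /andP[y0 y_le]; apply: f_le; lra.
have := ler_wpM2l K0 (moment_bound_le n0 q0 qp1); lra.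
Unshelve. all: by end_near. Qed.

End UniformLimits.

Section StatisticalConvergence.
Context {R : realType}.
Implicit Types (S T U : nat -> Prop) (N : nat).

Definition frequency S N : R :=
  N%:R^-1 * \sum_(1 <= j < N.+1) (if `[< S j >] then 1 else 0).

Lemma frequency_ge0 S N : 0 <= frequency S N.
Proof. by rewrite mulr_ge0 ?invr_ge0 // sumr_ge0 // => j _; case: ifP. Qed.

Lemma frequency_subU S T U N : (forall n, S n -> T n \/ U n) ->
  frequency S N <= frequency T N + frequency U N.
Proof.
move=> STU; rewrite -mulrDr ler_wpM2l ?invr_ge0 // -big_split /=.
apply: ler_sum => j _.
case: (asboolP (S j)) => [/STU|_]; last by rewrite addr_ge0 //; case: ifP.
by case=> /asboolT ->; [rewrite lerDl|rewrite lerDr]; case: ifP.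
Qed.

Lemma density_zero_subU S T U : (forall n, S n -> T n \/ U n) ->
  density_zero R T -> density_zero R U -> density_zero R S.
Proof.
move=> STU zT zU.
have zTU : frequency T N + frequency U N @[N --> \oo] --> (0 : R).
  by rewrite -[X in _ --> X](addr0 0); exact: cvgD zT zU.
apply: squeeze_cvgr (cvg_cst _) zTU; apply: nearW => N.
exact/andP/(conj (frequency_ge0 S N))/frequency_subU.
Qed.

Lemma density_zero_sub S T :
  (forall n, S n -> T n) -> density_zero R T -> density_zero R S.
Proof. by move=> ST zT; apply: (density_zero_subU _ zT zT) => n /ST; left. Qed.

Lemma density_zero_initial m : density_zero R (fun n => (n < m)%N).
Proof.
have cvg0 : (N%:R)^-1 * m.-1%:R @[N --> \oo] --> (0 : R).
  rewrite -[X in _ --> X](mul0r m.-1%:R); apply: cvgM; last exact: cvg_cst.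
  by rewrite -cvg_shiftS; exact: cvg_harmonic.
apply: cvg_trans cvg0; apply: near_eq_cvg; near=> N; congr (_ * _).
have mN : (m <= N.+1)%N by near: N; exists m => // N /=; exact: leqW.
under [RHS]eq_bigr do rewrite asboolb.
by rewrite -big_mkcond -(big_nat_widen _ _ _ predT) // sumr_const_nat subn1.
Unshelve. all: by end_near. Qed.

Lemma st_lim_near (x : nat -> R) (l : R) (D : set R) (P : nat -> R -> Prop) :
  st_lim x l -> (forall n, D (x n)) ->
  (\forall n \near \oo & y \near within D (nbhs l), P n y) ->
  density_zero R (fun n => ~ P n (x n)).
Proof.
move=> xl Dx [[/= A B] [[m _ mA] /nbhs_ballP[d /= d0 dB]] ABP].
apply: density_zero_subU (density_zero_initial m) (xl d d0) => n notP.
have [|mn] := ltnP n m; [by left|right].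
rewrite leNgt; apply/negP => xn; apply: notP.
apply: (ABP (n, x n)); split; first exact: mA.
by apply: dB (Dx n); rewrite /ball /= distrC.
Qed.

Lemma supnorm01_bounds (g : R -> R) (e : R) :
  (forall x, 0 <= x <= 1 -> `|g x| <= e) -> 0 <= supnorm01 g <= e.
Proof.
move=> g_le; set E := [set `|g x| | x in `[0, 1]%classic].
have E1 : E `|g 1| by exists 1; rewrite //= in_itv /= ler01 lexx.
have E_le : ubound E e.
  by move=> _ [x /= x01 <-]; apply: g_le; rewrite in_itv in x01.
rewrite ge_sup //; last by exists `|g 1|.
by rewrite andbT (le_trans (normr_ge0 (g 1))) // ub_le_sup //; exists e.
Qed.

End StatisticalConvergence.

Theorem theorem5 (R : realType) (p q : nat -> R) (a b : R)
  (hq0 : forall n, 0 < q n) (hqp : forall n, q n < p n) (hp1 : forall n, p n <= 1)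
  (hq : st_lim q 1) (hqn : st_lim (fun n => q n ^+ n) a)
  (hp : st_lim p 1) (hpn : st_lim (fun n => p n ^+ n) b)
  (f : R -> R) (hf : continuous f) :
  st_lim (fun n => supnorm01 (fun x => Mtilde (p n) (q n) n f x - f x)) 0.
Proof.
move=> eps eps0; have eps2 : 0 < eps / 2 by rewrite divr_gt0.
have q_lt1 n : q n < 1 := lt_le_trans (hqp n) (hp1 n).
have := st_lim_near hq q_lt1 (Mtilde_near_uniform hf eps2).
apply: density_zero_sub => n.
rewrite subr0 => eps_le Mtilde_le.
have /supnorm01_bounds/andP[sup_ge0 sup_le] x :
    0 <= x <= 1 -> `|Mtilde (p n) (q n) n f x - f x| <= eps / 2.
  by apply: Mtilde_le; rewrite hqp hp1.
move: eps_le; rewrite ger0_norm //; lra.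
Qed.
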